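(* Let $F$ be a field of characteristic two and let $(A,\sigma)$ be a totally decomposable $F$-algebra with orthogonal involution. Then the following conditions are equivalent: (1) $\sigma$ is anisotropic. (2) $\sigma$ is direct. (3) The bilinear Pfister form $\mathfrak{Pf}(A,\sigma)$ is anisotropic. (4) The alternator form $q_\sigma$ is anisotropic. (5) $\Phi(A,\sigma)$ is a field. (6) $S(A,\sigma)$ is a field. (7) $\Phi(A,\sigma)=S(A,\sigma)$. (8) $S(A,\sigma)\subseteq\mathrm{Sym}(A,\sigma)$, where $\mathrm{Sym}(A,\sigma)=\{x\in A\mid\sigma(x)=x\}$. In particular, if these conditions hold, the subalgebra $\Phi(A,\sigma)$ of $A$ is uniquely determined.
   Context: $F$ is a field of characteristic two; central simple algebras are finite-dimensional. An involution $\sigma$ on a central simple $F$-algebra $A$ is an anti-automorphism of order two; it is of the first kind if it is the identity on $F$. Put $\mathrm{Alt}(A,\sigma)=\{x-\sigma(x)\mid x\in A\}$. An involution of the first kind is orthogonal if and only if $1\notin\mathrm{Alt}(A,\sigma)$. For $\sigma$ orthogonal, define the alternator subalgebra $S(A,\sigma)=\{x\in A\mid \sigma(x)x\in F\oplus\mathrm{Alt}(A,\sigma)\}$ (it is a unitary $F$-subalgebra of $A$) and, for $x\in S(A,\sigma)$, let $q_\sigma(x)$ be the unique element of $F$ with $\sigma(x)x+q_\sigma(x)\in\mathrm{Alt}(A,\sigma)$; the map $q_\sigma:S(A,\sigma)\to F$ is a totally singular quadratic form (polar form zero), called the alternator form. The involution $\sigma$ is isotropic if $\sigma(x)x=0$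 for some nonzero $x\in A$, anisotropic otherwise; it is direct if for every $x\in A$, $\sigma(x)x\in\mathrm{Alt}(A,\sigma)$ implies $x=0$. A quadratic form $q$ (resp. bilinear form $\mathfrak b$) is isotropic if $q(v)=0$ (resp. $\mathfrak b(v,v)=0$) for some $v\ne0$, anisotropic otherwise. $(A,\sigma)$ is totally decomposable if $(A,\sigma)\simeq\bigotimes_{i=1}^n(Q_i,\sigma_i)$ with each $Q_i$ a quaternion $F$-algebra (central simple of degree 2) with involution $\sigma_i$; when $\sigma$ is orthogonal, each $\sigma_i$ is orthogonal. Writing $\mathrm{disc}\,\sigma_i=\alpha_iF^{\times2}$ with $\alpha_i\in F^\times$ (here $\mathrm{disc}\,\sigma_i\in F^\times/F^{\times2}$ is the class of the reduced norm of any unit in $\mathrm{Alt}(Q_i,\sigma_i)$), $\mathfrak{Pf}(A,\sigma)$ is the bilinear Pfister form $\langle\!\langle\alpha_1,\dots,\alpha_n\rangle\!\rangle=\bigotimes_{i=1}^n\langle1,\alpha_i\rangle$, where $\langle1,\alpha\rangle$ is the diagonal bilinear form $x_1y_1+\alpha x_2y_2$; up to isometry it is independent of the decomposition (known). $\Phi(A,\sigma)$ denotes an $F$-subalgebra of $A$ of dimension $2^n$ (where $\deg A=2^n$), contained in $F\oplus\mathrm{Alt}(A,\sigma)$, such that (i) $x^2\in F$ for all $x\in\Phi(A,\sigma)$; (ii) the centralizer of $\Phi(A,\sigma)$ in $A$ is $\Phi(A,\sigma)$ itself; (iii) $\Phi(A,\sigma)$ is generated as an $F$-algebra by $n$ elements.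 Such a subalgebra exists and is unique up to isomorphism (known); ''uniquely determined'' means that there is exactly one such subalgebra of $A$. *)

(* Defs.v *)
From HB Require Import structures.
From mathcomp Require Import all_boot all_order all_algebra all_field.

Set Implicit Arguments.
Unset Strict Implicit.
Unset Printing Implicit Defensive.

Import GRing.Theory.
Local Open Scope ring_scope.

(** * Central simple algebras and their subalgebras *)

(* Two-sided ideals of the unital F-algebra A are automatically F-subspaces. *)
Definition central_simple (F : fieldType) (A : falgType F) : Prop :=
  'Z({:A})%VS = 1%VS /\
  forall I : {vspace A},
    ({:A} * I <= I)%VS -> (I * {:A} <= I)%VS -> I = 0%VS \/ I = {:A}%VS.

Definition quaternion_algebra (F : fieldType) (Q : falgType F) : Prop :=
  central_simple Q /\ \dim {:Q} = 4.

(* P, with the operations of the ambient algebra, is a field. *)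
Definition is_field (F : fieldType) (A : falgType F) (P : {pred A}) : Prop :=
  [/\ subring_closed P,
      {in P &, commutative *%R} &
      {in P, forall x, x != 0 -> exists2 y, y \in P & x * y = 1}].

(** * Involutions *)

(* An anti-automorphism of the F-algebra A is the identity on F if and only if
   it is F-linear. *)
Definition involution_first_kind (F : fieldType) (A : falgType F)
    (sigma : {linear A -> A}) : Prop :=
  [/\ forall x y, sigma (x * y) = sigma y * sigma x,
      involutive sigma &
      ~ sigma =1 id].

Definition Alt (F : fieldType) (A : falgType F) (sigma : {linear A -> A})
    : {vspace A} :=
  limg (\1 - linfun sigma)%VF.

Definition Sym (F : fieldType) (A : falgType F) (sigma : {linear A -> A})
    : {pred A} :=
  [pred x | sigma x == x].

(* Meant for involutions of the first kind in characteristic two. *)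
Definition orthogonal_inv (F : fieldType) (A : falgType F)
    (sigma : {linear A -> A}) : Prop :=
  1 \notin Alt sigma.

Definition inv_isotropic (F : fieldType) (A : falgType F)
    (sigma : {linear A -> A}) : Prop :=
  exists2 x, x != 0 & sigma x * x = 0.

Definition inv_direct (F : fieldType) (A : falgType F)
    (sigma : {linear A -> A}) : Prop :=
  forall x, sigma x * x \in Alt sigma -> x = 0.

(** * The alternator subalgebra and the alternator form *)

Definition alternator_subalgebra (F : fieldType) (A : falgType F)
    (sigma : {linear A -> A}) : {pred A} :=
  [pred x | sigma x * x \in (1 + Alt sigma)%VS].

(* The scalar component of sigma x * x along the decomposition of 1 + Alt sigma
   as a direct sum; see [alternator_formP]. *)
Definition alternator_form (F : fieldType) (A : falgType F)
    (sigma : {linear A -> A}) (x : A) : F :=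
  coord [tuple (1 : A)] 0 (daddv_pi 1%VS (Alt sigma) (sigma x * x)).

Lemma alternator_formP (F : fieldType) (A : falgType F)
    (sigma : {linear A -> A}) (x : A) (a : F) :
  2%N \in [pchar F] -> orthogonal_inv sigma ->
  x \in alternator_subalgebra sigma ->
  (sigma x * x + a%:A \in Alt sigma) = (a == alternator_form sigma x).
Proof.
move=> F2 h1; rewrite inE => hS.
have N1 (v : A) : - v = v.
  rewrite -[LHS]scaleN1r; suff -> : -1 = 1 :> F by rewrite scale1r.
  by rewrite (oppr_pchar2 F2).
have dxU : (1 :&: Alt sigma = 0 :> {vspace A})%VS.
  apply/eqP; rewrite -subv0; apply/subvP => v; rewrite memv_cap => /andP[].
  move=> /vlineP[k ->] kA.
  have [->|k0] := eqVneq k 0; first by rewrite scale0r mem0v.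
  case/negP: h1; have := memvZ k^-1 kA.
  by rewrite scalerA mulVf // scale1r.
pose y := sigma x * x; rewrite /alternator_form -/y in hS *.
have hy := daddv_pi_add dxU hS.
set p := daddv_pi 1%VS (Alt sigma) y in hy *.
have hp : p \in 1%VS by apply: memv_pi.
have hq : daddv_pi (Alt sigma) 1%VS y \in Alt sigma by apply: memv_pi.
have ep : p = (coord [tuple (1 : A)] 0 p)%:A.
  have hp1 : p \in <<[tuple (1%R : A)]>>%VS by rewrite span_seq1.
  by rewrite {1}(coord_span hp1) big_ord1.
set c := coord _ _ _ in ep *.
rewrite -hy ep addrAC rpredDr // -[X in _ + X]N1 -scalerBl.
apply/idP/eqP => [h|->]; last by rewrite subrr scale0r mem0v.
apply/eqP; rewrite eq_sym -subr_eq0; apply: contraNT h1 => nz.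
by have := memvZ (c - a)^-1 h; rewrite scalerA mulVf // scale1r.
Qed.

(** * Isotropy of quadratic and bilinear forms *)

(* The quadratic form q is considered on the subspace P of V. *)
Definition quad_isotropic (F : fieldType) (V : lmodType F) (P : {pred V})
    (q : V -> F) : Prop :=
  exists v, [/\ v \in P, v != 0 & q v = 0].

Definition bilin_isotropic (F : fieldType) (V : lmodType F)
    (b : V -> V -> F) : Prop :=
  exists2 v, v != 0 & b v v = 0.

(** * Tensor products of algebras with involution *)

Definition multilinear_map (F : fieldType) (n : nat) (Q : 'I_n -> falgType F)
    (V : lmodType F) (m : (forall i, Q i) -> V) : Prop :=
  forall (x : forall i, Q i) (i : 'I_n) (a : F) (y z : Q i),
    m (dfwith x (a *: y + z)) = a *: m (dfwith x y) + m (dfwith x z).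

(* The vector space T together with t : (x_i)_i |-> x_1 (x) ... (x) x_n is the
   tensor product of the Q i: every multilinear map factors uniquely through
   t. *)
Definition is_tensor_product (F : fieldType) (n : nat) (Q : 'I_n -> falgType F)
    (T : lmodType F) (t : (forall i, Q i) -> T) : Prop :=
  multilinear_map t /\
  forall (V : lmodType F) (m : (forall i, Q i) -> V), multilinear_map m ->
    (exists f : {linear T -> V}, forall x, f (t x) = m x) /\
    (forall f g : {linear T -> V},
       (forall x, f (t x) = m x) -> (forall x, g (t x) = m x) -> f =1 g).

(* (A, sigma) is the tensor product of the quaternion algebras with involution
   (Q i, tau i), where t x is the pure tensor x_1 (x) ... (x) x_n. The last
   three clauses determine the multiplication of A and sigma. *)
Record tensor_decomposition (F : fieldType) (A : falgType F)
    (sigma : {linear A -> A}) (n : nat) (Q : 'I_n -> falgType F)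
    (tau : forall i, {linear Q i -> Q i}) (t : (forall i, Q i) -> A) : Prop := {
  td_quaternion : forall i, quaternion_algebra (Q i);
  td_involution : forall i, involution_first_kind (tau i);
  td_tensor : is_tensor_product t;
  td_one : t (fun i => 1) = 1;
  td_mul : forall x y, t x * t y = t (fun i => x i * y i);
  td_inv : forall x, sigma (t x) = t (fun i => tau i (x i))
}.

(** * Discriminants and the Pfister form *)

(* a is the reduced norm of x: the determinant of x in a splitting
   representation over an extension K of F. For a quaternion algebra Q, an
   F-algebra morphism from Q to 2 x 2 matrices over K is the same as an
   isomorphism of K-algebras from the scalar extension of Q to K onto the
   matrix algebra. *)
Definition quaternion_reduced_norm (F : fieldType) (Q : falgType F)
    (x : Q) (a : F) : Prop :=
  exists (K : fieldType) (iota : {rmorphism F -> K})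
         (rho : {rmorphism Q -> 'M[K]_2}),
    (forall c : F, rho c%:A = (iota c)%:M) /\ \det (rho x) = iota a.

(* disc tau is the class of a modulo nonzero squares. *)
Definition quaternion_disc (F : fieldType) (Q : falgType F)
    (tau : {linear Q -> Q}) (a : F) : Prop :=
  a != 0 /\
  exists (u : Q) (d c : F),
    [/\ u \in Alt tau, u \is a GRing.unit, quaternion_reduced_norm u d,
        c != 0 & a = d * c ^+ 2].

(* The Gram matrix of <1, a>. *)
Definition gram1 (F : fieldType) (a : F) : 'M[F]_2 :=
  \matrix_(i, j) (if i == j then (if i == 0 then 1 else a) else 0).

(* The tensor product <1, alpha_1> (x) ... (x) <1, alpha_n>: the basis vectors
   e_(k_1) (x) ... (x) e_(k_n) of the tensor power of F^2 are indexed by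
   k : {ffun 'I_n -> 'I_2}. *)
Definition pfister (F : fieldType) (n : nat) (alpha : 'I_n -> F)
    (u v : {ffun {ffun 'I_n -> 'I_2} -> F^o}) : F :=
  \sum_k \sum_l u k * v l * \prod_i gram1 (alpha i) (k i) (l i).

(** * The subalgebras denoted by Phi(A, sigma) *)

Record is_Phi (F : fieldType) (A : falgType F) (sigma : {linear A -> A})
    (n : nat) (Phi : {aspace A}) : Prop := {
  (* elements of {aspace A} need not contain the identity of A *)
  Phi_one : 1 \in Phi;
  Phi_dim : \dim Phi = (2 ^ n)%N;
  Phi_alt : (Phi <= 1 + Alt sigma)%VS;
  Phi_sqr : forall x, x \in Phi -> x ^+ 2 \in 1%VS;
  Phi_cent : 'C(Phi)%VS = Phi;
  Phi_gen : exists s : n.-tuple A, (Phi : {vspace A}) = <<1 & s>>%VS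
}.

(* Main.v *)
(* For x, y in S(A, sigma) one has q(x y + y x) = 0, because q is additive and
   multiplicative. So if q is anisotropic then S(A, sigma) is commutative, and
   being contained in the centralizer of Phi, which is Phi, it is equal to Phi.
   Conversely, if q(x) = 0 with x <> 0, then iterated commutators with elements
   of Phi (which square to scalars) lead from x to a nonzero y in Phi with
   y^2 = q(y) = 0, so Phi is not a field. Finally, if x in Phi has square 0, then
   x A is contained in S(A, sigma); if moreover S(A, sigma) = Phi then
   x A x = 0, hence x = 0 as A is simple.

   A subalgebra Phi that computes the Pfister form is generated by units v_i of
   Alt(Q_i, sigma_i) with v_i^2 = alpha_i: the squaring map on the basis of
   monomials in the v_i is the diagonal of the Pfister form. *)

Require Import Defs.
From Stdlib Require Import FunctionalExtensionality.
From HB Require Import structures.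
From mathcomp Require Import all_boot all_order all_algebra all_field.

Set Implicit Arguments.
Unset Strict Implicit.
Unset Printing Implicit Defensive.

Import GRing.Theory.
Local Open Scope ring_scope.

(** * The alternator form *)

(** The ideal [A x A] is 0 or [A]. In the first case it contains [x = 1 x 1]; in the second,
    [x A x = 0] gives [x A = 0]. *)
Lemma central_simple_semiprime (F : fieldType) (A : falgType F) (x : A) :
  central_simple A -> (forall a, x * a * x = 0) -> x = 0.
Proof.
case=> _ simpleA xAx0; pose I := ({:A} * <[x]> * {:A})%VS.
have [||I0|IA] := simpleA I.
- by rewrite !prodvA prodvSl // prodvSl ?subvf.
- by rewrite -prodvA prodvSr ?subvf.
- apply/eqP; rewrite -memv0 -I0 -[x]mul1r -[1 * x]mulr1.
  by rewrite !memv_mul ?memvf ?memv_line.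
- have : (<[x]> * I <= 0)%VS.
    rewrite !prodvA; apply/prodvP=> y a /[swap] _.
    suff /subvP/[apply] : (<[x]> * {:A} * <[x]> <= 0)%VS.
      by rewrite memv0 => /eqP->; rewrite mul0r mem0v.
    apply/prodvP=> z w zP /vlineP[k ->]; rewrite -scalerAr memvZ //.
    suff /subvP/(_ z zP) : (<[x]> * {:A} <= lker (amulr x))%VS.
      by rewrite memv_ker lfunE memv0.
    apply/prodvP=> _ b /vlineP[l ->] _.
    by rewrite memv_ker lfunE /= -!scalerAl xAx0 scaler0.
  rewrite IA => /subvP/(_ (x * 1)); rewrite memv_mul ?memv_line ?memvf //.
  by rewrite mulr1 memv0 => /(_ isT)/eqP.
Qed.

Section Involution.

Variables (F : fieldType) (A : falgType F) (sigma : {linear A -> A}).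
Hypotheses (charF2 : 2%N \in [pchar F]) (sigma_inv : involution_first_kind sigma).

Let charA2 : 2%N \in [pchar A].
Proof. by rewrite (pchar_lalg A). Qed.

Let N := oppr_pchar2 charA2.
Let sigmaM x y : sigma (x * y) = sigma y * sigma x.
Proof. by case: sigma_inv. Qed.
Let sigmaK : involutive sigma.
Proof. by case: sigma_inv. Qed.

Lemma memAltP (x : A) : reflect (exists y, x = y + sigma y) (x \in Alt sigma).
Proof.
rewrite /Alt; apply: (iffP memv_imgP) => [[y _ ->]|[y ->]].
  by exists y; rewrite add_lfunE opp_lfunE id_lfunE lfunE N.
by exists y; rewrite ?memvf // add_lfunE opp_lfunE id_lfunE lfunE N.
Qed.

Lemma mem_Alt (x : A) : x + sigma x \in Alt sigma.
Proof. by apply/memAltP; exists x. Qed.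

Lemma Alt_fixed (x : A) : x \in Alt sigma -> sigma x = x.
Proof. by move=> /memAltP[y ->]; rewrite linearD sigmaK addrC. Qed.

Lemma involution1 : sigma 1 = 1.
Proof. by rewrite -[LHS]mul1r -{1}[1]sigmaK -sigmaM mul1r sigmaK. Qed.

Lemma Alt_conj (x a : A) : a \in Alt sigma -> sigma x * a * x \in Alt sigma.
Proof.
move=> /memAltP[b ->]; apply/memAltP; exists (sigma x * b * x).
by rewrite !sigmaM sigmaK mulrDr mulrDl !mulrA.
Qed.

Lemma scalar_Alt_fixed (x : A) : x \in (1 + Alt sigma)%VS -> sigma x = x.
Proof.
case/memv_addP=> _ /vlineP[k ->] [y /Alt_fixed sy ->].
by rewrite linearD linearZ_LR involution1 sy.
Qed.

Lemma alternatorP (x : A) :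
  reflect (exists c : F, sigma x * x + c%:A \in Alt sigma)
          (x \in alternator_subalgebra sigma).
Proof.
rewrite inE; apply: (iffP memv_addP) => [[_ /vlineP[k ->] [y yA ->]]|[c cA]].
  by exists k; rewrite addrAC (addrr_pchar2 charA2) add0r.
exists c%:A; first by rewrite memvZ ?memv_line.
by exists (sigma x * x + c%:A); rewrite // addrC -addrA (addrr_pchar2 charA2) addr0.
Qed.

(* The terms [sigma x * y + sigma y * x] lie in [Alt sigma]: this is why the
   alternator form is additive. *)
Lemma alternatorD (x y : A) (a b : F) :
  sigma x * x + a%:A \in Alt sigma -> sigma y * y + b%:A \in Alt sigma ->
  sigma (x + y) * (x + y) + (a + b)%:A \in Alt sigma.
Proof.
move=> xA yA.
have -> : sigma (x + y) * (x + y) + (a + b)%:A =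
    (sigma x * x + a%:A) + (sigma y * y + b%:A)
    + (sigma x * y + sigma (sigma x * y)).
  rewrite linearD mulrDl !mulrDr sigmaM sigmaK scalerDl.
  by rewrite (@GRing.add A).[AC (2*2*2) ((1*5)*(4*6)*(2*3))].
by apply: memvD; [apply: memvD | apply: mem_Alt].
Qed.

(** Here [sigma (x * y) * (x * y)] is [sigma x * x] between [sigma y] and [y], and this operation
    preserves [Alt sigma]. Hence the alternator form is multiplicative. *)
Lemma alternatorM (x y : A) (a b : F) :
  sigma x * x + a%:A \in Alt sigma -> sigma y * y + b%:A \in Alt sigma ->
  sigma (x * y) * (x * y) + (a * b)%:A \in Alt sigma.
Proof.
move=> xA yA.
have -> : sigma (x * y) * (x * y) + (a * b)%:A =
    sigma y * (sigma x * x + a%:A) * y + a *: (sigma y * y + b%:A).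
  rewrite sigmaM mulrDr mulrDl !mulrA scalerDr scalerA -!addrA; congr (_ + _).
  by rewrite addrA -scalerAr mulr1 -scalerAl (addrr_pchar2 charA2) add0r.
by apply: memvD; [apply: Alt_conj | apply: memvZ].
Qed.

End Involution.

(** * Self-centralizing subalgebras and the alternator subalgebra *)

Section SelfCentralizing.

Variables (F : fieldType) (A : falgType F) (sigma : {linear A -> A}).
Hypotheses (charF2 : 2%N \in [pchar F]) (sigma_inv : involution_first_kind sigma).
Variables (n : nat) (Phi : {aspace A}).
Hypotheses (sigma_orth : orthogonal_inv sigma) (PhiP : is_Phi sigma n Phi).

Local Notation S := (alternator_subalgebra sigma).

Let charA2 : 2%N \in [pchar A].
Proof. by rewrite (pchar_lalg A). Qed.

Lemma PhiC : {in Phi &, commutative *%R}.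
Proof. by apply/centvsP; rewrite (Phi_cent PhiP). Qed.

Lemma Phi_fixed x : x \in Phi -> sigma x = x.
Proof. by move/(subvP (Phi_alt PhiP))/(scalar_Alt_fixed charF2 sigma_inv). Qed.

Lemma Phi_scalar_sqr x : x \in Phi -> exists c : F, x * x = c%:A.
Proof. by move/(Phi_sqr PhiP)/vlineP. Qed.

Lemma Phi_sub_alternator : {subset Phi <= S}.
Proof.
move=> x xPhi; apply/alternatorP => //; have [c xx] := Phi_scalar_sqr xPhi.
by exists c; rewrite Phi_fixed // xx (addrr_pchar2 charA2) mem0v.
Qed.

(** If [x] has nonzero scalar square [c], its inverse is [c^-1 *: x]. The absence of square-zero
    elements is the form in which the field condition meets the others. *)
Lemma Phi_field_reduced :
  is_field (mem Phi) <-> (forall x, x \in Phi -> x * x = 0 -> x = 0).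
Proof.
split=> [[_ _ inv] x xPhi xx|red].
  have [//|/(inv x xPhi)[y _ xy]] := eqVneq x 0.
  by rewrite -[x]mulr1 -xy mulrA xx mul0r.
split=> [|x y xPhi yPhi|x xPhi x0]; last 2 first.
- exact: PhiC.
- have [c xx] := Phi_scalar_sqr xPhi.
  have c0 : c != 0.
    by apply: contra_neq x0 => c0; apply: red; rewrite // xx c0 scale0r.
  exists (c^-1 *: x); first exact: memvZ.
  by rewrite -scalerAr xx scalerA mulVf // scale1r.
- split=> [|x y|x y]; [exact: Phi_one PhiP | exact: memvB | exact: memvM].
Qed.

(* For y in Phi, the commutator with y squares to the commutator with the scalar
   [y * y], that is, to 0; so replacing x by nonzero commutators ends with an
   element that commutes with Phi, hence lies in Phi. *)
Lemma Phi_reduced_direct :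
  (forall x, x \in Phi -> x * x = 0 -> x = 0) -> inv_direct sigma.
Proof.
move=> red x xA; have [//|x0] := eqVneq x 0; exfalso.
have comm_with (s : seq A) : {subset s <= Phi} ->
    exists z, [/\ z != 0, sigma z * z \in Alt sigma &
                  {in s, forall y, y * z = z * y}].
  elim: s => [_|y s IHs ysPhi]; first by exists x; split.
  have [|z [z0 zA zC]] := IHs; first by move=> w ws; apply: ysPhi; rewrite inE ws orbT.
  have yPhi : y \in Phi by apply: ysPhi; rewrite mem_head.
  have [yz|nyz] := eqVneq (y * z + z * y) 0.
    exists z; split=> // w; rewrite inE => /predU1P[->|/zC//].
    by rewrite -[LHS]addr0 -(addrr_pchar2 charA2 (z * y)) addrA yz add0r.
  have [c yy] := Phi_scalar_sqr yPhi.
  exists (y * z + z * y); split=> //.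
    (* By multiplicativity the form vanishes on [y z] and [z y] as it does on [z], hence also on
       their sum. *)
    have zA0 : sigma z * z + (0 : F)%:A \in Alt sigma by rewrite scale0r addr0.
    have yA : sigma y * y + c%:A \in Alt sigma.
      by rewrite Phi_fixed // yy (addrr_pchar2 charA2) mem0v.
    have := alternatorD charF2 sigma_inv (alternatorM charF2 sigma_inv yA zA0)
                        (alternatorM charF2 sigma_inv zA0 yA).
    by rewrite mulr0 mul0r addr0 scale0r addr0.
  (* The new element commutes with [y], since both products equal [c z + y z y]. It commutes with
     the earlier [w], since these commute with [y] and [z]. *)
  move=> w; rewrite inE => /predU1P[->|ws].
    rewrite mulrDr mulrDl !mulrA -[z * y * y]mulrA yy -scalerAl mul1r.
    by rewrite -scalerAr mulr1 addrC.
  have wy : w * y = y * w by apply: PhiC => //; apply: ysPhi; rewrite inE ws orbT.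
  by rewrite mulrDr mulrDl !mulrA wy (zC w ws) -!mulrA (zC w ws) wy.
have [|z [z0 zA zC]] := comm_with (vbasis Phi).
  by move=> y /vbasis_mem.
have zPhi : z \in Phi.
  rewrite -(Phi_cent PhiP) -subv_cent1 -(span_basis (vbasisP Phi)).
  by apply/span_subvP => y yPhi; apply/cent1vP/zC.
have [c zz] := Phi_scalar_sqr zPhi.
(* A nonzero scalar in [Alt sigma] would put 1 there, against orthogonality; so [z * z = 0]. *)
have : c%:A \in Alt sigma by rewrite -zz -{1}(Phi_fixed zPhi).
have [c0 _|c0 cA] := eqVneq c 0.
  by case/eqP: z0; apply: red => //; rewrite zz c0 scale0r.
case/negP: sigma_orth; rewrite -(scale1r 1) -(mulVf c0) -scalerA.
exact: memvZ.
Qed.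

Lemma direct_alternatorE : inv_direct sigma -> Phi =i S.
Proof.
move=> dir x; apply/idP/idP => [/Phi_sub_alternator//|xS].
rewrite -(Phi_cent PhiP); apply/centvP => y /Phi_sub_alternator yS.
have /(alternatorP _ charF2)[a xA] := xS; have /(alternatorP _ charF2)[b yA] := yS.
have xyA := alternatorM charF2 sigma_inv xA yA.
have yxA := alternatorM charF2 sigma_inv yA xA.
(* The form takes the value [a b + b a = 0] at [x y + y x]. *)
have := alternatorD charF2 sigma_inv xyA yxA.
rewrite mulrC (addrr_pchar2 charF2) scale0r addr0 => /dir/eqP.
by rewrite addr_eq0 (oppr_pchar2 charA2) => /eqP.
Qed.

Lemma alternator_field_reduced :
  is_field S -> forall x, x \in Phi -> x * x = 0 -> x = 0.
Proof.
move=> [_ _ inv] x /Phi_sub_alternator xS xx.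
have [//|/(inv x xS)[y _ xy]] := eqVneq x 0.
by rewrite -[x]mulr1 -xy mulrA xx mul0r.
Qed.

(** For [x] in [S] and [y] in [Phi], the elements [x], [y] and [x y] all lie in [S], hence are
    symmetric, and [x y = sigma (x y) = y x]. *)
Lemma alternator_sym_Phi : {subset S <= Sym sigma} -> Phi =i S.
Proof.
move=> SSym x; apply/idP/idP => [/Phi_sub_alternator//|xS].
rewrite -(Phi_cent PhiP); apply/centvP => y /Phi_sub_alternator yS.
have /(alternatorP _ charF2)[a xA] := xS; have /(alternatorP _ charF2)[b yA] := yS.
have : x * y \in S.
  apply/alternatorP => //; exists (a * b); exact: alternatorM.
have [/SSym/eqP sx /SSym/eqP sy] := (xS, yS).
by case: sigma_inv => sigmaM _ _ /SSym/eqP; rewrite sigmaM sx sy.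
Qed.

(* If [x ^+ 2 = 0] then [x * A] is contained in the alternator subalgebra. *)
Lemma alternatorE_reduced :
  central_simple A -> Phi =i S -> forall x, x \in Phi -> x * x = 0 -> x = 0.
Proof.
move=> csA PhiS x xPhi xx; apply: (central_simple_semiprime csA) => a.
(* Since [sigma (x a) * (x a) = sigma a * x * x * a = 0], the product [x a] lies in the alternator
   subalgebra. *)
have xaPhi : x * a \in Phi.
  rewrite PhiS; apply/alternatorP => //; exists 0.
  case: sigma_inv => -> _ _; rewrite (Phi_fixed xPhi) -mulrA [x * _]mulrA xx.
  by rewrite mul0r mulr0 scale0r addr0 mem0v.
by rewrite (PhiC xaPhi xPhi) mulrA xx mul0r.
Qed.

Lemma anisotropic_reduced :
  ~ inv_isotropic sigma -> forall x, x \in Phi -> x * x = 0 -> x = 0.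
Proof.
move=> anis x xPhi xx; have [//|x0] := eqVneq x 0.
by case: anis; exists x; rewrite ?Phi_fixed.
Qed.

End SelfCentralizing.

Lemma direct_anisotropic (F : fieldType) (A : falgType F)
    (sigma : {linear A -> A}) : inv_direct sigma -> ~ inv_isotropic sigma.
Proof.
by move=> dir [x x0 xx]; case/eqP: x0; apply: dir; rewrite xx mem0v.
Qed.

Lemma direct_quad_anisotropic (F : fieldType) (A : falgType F)
    (sigma : {linear A -> A}) :
  2%N \in [pchar F] -> involution_first_kind sigma -> orthogonal_inv sigma ->
  inv_direct sigma <->
  ~ quad_isotropic (alternator_subalgebra sigma) (alternator_form sigma).
Proof.
move=> charF2 sigma_inv sigma_orth; split=> [dir [x [xS /eqP x0 qx]]|anis x xA].
  apply/x0/dir; rewrite -[_ * _]addr0 -(scale0r 1).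
  by rewrite alternator_formP // qx.
have [//|x0] := eqVneq x 0; case: anis; exists x.
have {}xA : sigma x * x + (0 : F)%:A \in Alt sigma by rewrite scale0r addr0.
have xS : x \in alternator_subalgebra sigma by apply/alternatorP => //; exists 0.
by split=> //; move: xA; rewrite alternator_formP // => /eqP.
Qed.

Lemma eq_is_field (F : fieldType) (A : falgType F) (P P' : {pred A}) :
  P =i P' -> is_field P -> is_field P'.
Proof.
move=> eqP [[P1 PB PM] PC PV]; split=> [|x y|x].
- by split=> [|x y|x y]; rewrite -!eqP //; [apply: PB | apply: PM].
- by rewrite -!eqP; apply: PC.
- by rewrite -eqP => xP /(PV x xP)[y yP xy]; exists y; rewrite -?eqP.
Qed.

(** * Quaternion algebras *)

(* If no commutator [v, x] is invertible, then they all lie on a line F r of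
   F + F v with r ^+ 2 = 0, so r Q r = 0, which contradicts simplicity. *)
Lemma inner_derivation_one (F : fieldType) (Q : falgType F) (v : Q) (a : F) :
  2%N \in [pchar F] -> central_simple Q -> v * v = a%:A -> v \notin 1%VS ->
  (forall x, exists b c : F, v * x + x * v = b%:A + c *: v) ->
  exists z, v * z + z * v = 1.
Proof.
move=> charF2 csQ vv vN1 br.
have charQ2 : 2%N \in [pchar Q] by rewrite (pchar_lalg Q).
pose e (b c : F) : Q := b%:A + c *: v.
have ee (b c : F) : e b c * e b c = (b ^+ 2 + c ^+ 2 * a)%:A.
  rewrite mulrDl !mulrDr -!scalerAl !mul1r -!scalerAr mulr1 vv !scalerA scalerDl.
  rewrite (@GRing.add Q).[AC (2*2) ((1*4)*(2*3))] [c * b]mulrC.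
  by rewrite (addrr_pchar2 charQ2) addr0 !expr2.
have ve (b c : F) : v * e b c = e b c * v.
  by rewrite mulrDl mulrDr -!scalerAl -!scalerAr mul1r mulr1.
(* When [e b c] has nonzero square [k], it commutes with [v], so [[v, k^-1 e x] = k^-1 e e = 1]. *)
have done_if x b c : v * x + x * v = e b c -> b ^+ 2 + c ^+ 2 * a != 0 ->
    exists z, v * z + z * v = 1.
  move=> vx; move: (b ^+ 2 + _) (ee b c) => k eek k0; exists (k^-1 *: (e b c * x)).
  rewrite -scalerAr -scalerAl -scalerDr mulrA ve -!mulrA -mulrDr vx eek scalerA.
  by rewrite mulVf // scale1r.
have /subvPn[x _] : ~~ ({:Q} <= 'C[v])%VS.
  apply: contra vN1; rewrite subv_cent1 => vC; case: csQ => <- _.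
  by rewrite memv_cap memvf.
move/cent1vP/eqP; rewrite -subr_eq0 (oppr_pchar2 charQ2) addrC.
have [b [c vx]] := br x; rewrite vx -/(e b c) => r0.
have [n0|/(done_if _ _ _ vx)//] := eqVneq (b ^+ 2 + c ^+ 2 * a) 0.
(* Either all commutators lie on the line of [r = e b c], or some [[v, y]] lies off it. The latter
   has nonzero square, because every element of [F + F v] with square 0 is a multiple of [r]. *)
have [sub|/subvPn[_ /memv_imgP[y _ ->]]] :=
    boolP (limg (amull v + amulr v)%R <= <[e b c]>)%VS; last first.
  rewrite add_lfunE !lfunE /=; have [b' [c' vy]] := br y.
  rewrite vy -/(e b' c') => /negP sr; apply: (done_if _ _ _ vy); apply/negP=> n0'.
  have c0 : c != 0.
    apply: contraNneq r0 => c0; move: n0; rewrite c0 expr0n mul0r addr0.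
    by move/eqP; rewrite sqrf_eq0 /e scale0r => /eqP->; rewrite scale0r addr0.
  apply/sr/vlineP; exists (c' / c).
  rewrite /e scalerDr !scalerA divfK //; congr (_ *: _ + _).
  apply/eqP; rewrite mulrAC eq_sym -(inj_eq (mulIf c0)) divfK //.
  have F2 (s t : F) : s + t = 0 -> s = t.
    by move/eqP; rewrite addr_eq0 (oppr_pchar2 charF2) => /eqP.
  have : (c' * b) ^+ 2 == (b' * c) ^+ 2.
    by rewrite !exprMn (F2 _ _ n0) (F2 _ _ (eqP n0')) mulrCA mulrC -mulrA mulrCA.
  by rewrite eqf_sqr (oppr_pchar2 charF2) orbb eq_sym.
suff /eqP : e b c = 0 by rewrite (negPf r0).
apply: (central_simple_semiprime csQ) => y.
have : v * y + y * v \in <[e b c]>%VS.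
  apply/(subvP sub)/memv_imgP; exists y; rewrite ?memvf //.
  by rewrite add_lfunE !lfunE.
case/vlineP=> k vy.
(* With [r = b + c v] and [[v, y] = k r], moving [r] past [y] costs [c k r]; a further factor [r] on
   the right leaves only multiples of [r^2 = 0]. *)
have -> : e b c * y = y * e b c + (c * k) *: e b c.
  rewrite -scalerA -vy /e mulrDl mulrDr -!scalerAl -!scalerAr mul1r mulr1.
  by rewrite scalerDr -addrA [c *: (y * v) + _]addrC -addrA (addrr_pchar2 charQ2) addr0.
by rewrite mulrDl -mulrA -scalerAl ee n0 scale0r mulr0 scaler0 addr0.
Qed.

(** [Alt tau] is the image of [f] and lies in its kernel, the symmetric elements. The two dimensions
    add up to 4, so [\dim (Alt tau) > 1] would make them equal and put 1 in [Alt tau]. *)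
Lemma quaternion_Alt_line (F : fieldType) (Q : falgType F)
    (tau : {linear Q -> Q}) (u : Q) :
  2%N \in [pchar F] -> involution_first_kind tau -> orthogonal_inv tau ->
  \dim {:Q} = 4 -> u \in Alt tau -> u != 0 -> Alt tau = <[u]>%VS.
Proof.
move=> charF2 tau_inv tau_orth dimQ uA u0.
pose f := (\1 - linfun tau)%VF.
have fE x : f x = x - tau x by rewrite add_lfunE opp_lfunE id_lfunE lfunE.
have AltS : (Alt tau <= lker f)%VS.
  by apply/subvP=> x /(Alt_fixed charF2 tau_inv) tx; rewrite memv_ker fE tx subrr.
apply/esym/eqP; rewrite eqEdim -memvE uA dim_vline u0 leqNgt.
apply: contra tau_orth => dimA.
suff -> : Alt tau = lker f by rewrite memv_ker fE involution1 // subrr.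
apply/eqP; rewrite eqEdim AltS /=.
have := limg_ker_dim f fullv; rewrite capfv dimQ -/(Alt tau) => dims.
by rewrite -(leq_add2r (\dim (Alt tau))) dims (leq_add dimA dimA).
Qed.

(** The element [v] is a unit of [Alt tau] rescaled so that its square is the given representative
    of the discriminant. The last two clauses serve to construct [slot_ad] and control its
    values. *)
Lemma quaternion_disc_generator (F : fieldType) (Q : falgType F)
    (tau : {linear Q -> Q}) (a : F) :
  2%N \in [pchar F] -> quaternion_algebra Q -> involution_first_kind tau ->
  orthogonal_inv tau -> quaternion_disc tau a ->
  exists v : Q,
    [/\ v \in Alt tau, v * v = a%:A, free [:: 1; v],
        forall x, v * x + x * v \in (1 + <[v]>)%VS &
        exists z, v * z + z * v = 1].
Proof.
move=> charF2 [csQ dimQ] tau_inv tau_orth [a0 [u [d [c [uA uU nrd c0 ae]]]]].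
have charQ2 : 2%N \in [pchar Q] by rewrite (pchar_lalg Q).
have u0 : u != 0 by apply: contraTneq uU => ->; rewrite unitr0.
have AltE := quaternion_Alt_line charF2 tau_inv tau_orth dimQ uA u0.
(* [tau u * u * u = u ^+ 3] lies in [Alt tau = F u], and [u] is a unit. *)
have [k uu] : exists k : F, u * u = k%:A.
  have : tau u * u * u \in Alt tau by apply: Alt_conj.
  rewrite (Alt_fixed charF2 tau_inv uA) AltE => /vlineP[k uuu]; exists k.
  by apply: (mulIr uU); rewrite uuu -scalerAl mul1r.
(* Determinants in the splitting representation give [k^2 = d^2], and squaring is injective in
   characteristic two. *)
have kd : k = d.
  have [K [iota [rho [rhoZ detu]]]] := nrd.
  have : \det (rho (u * u)) = iota d ^+ 2.
    by rewrite rmorphM /= -mulmxE det_mulmx detu expr2.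
  rewrite uu rhoZ det_scalar -!rmorphXn => /fmorph_inj/eqP.
  by rewrite eqf_sqr (oppr_pchar2 charF2) orbb => /eqP.
exists (c *: u).
have vA : c *: u \in Alt tau by rewrite memvZ.
have vv : (c *: u) * (c *: u) = a%:A.
  by rewrite -scalerAl -scalerAr uu kd !scalerA ae [d * _]mulrC expr2 ?mulrA.
have v0 : c *: u != 0 by rewrite scaler_eq0 negb_or c0.
move: (c *: u) vA vv v0 => v vA vv v0.
have {}AltE := quaternion_Alt_line charF2 tau_inv tau_orth dimQ vA v0.
have vN1 : v \notin 1%VS.
  apply: contra tau_orth => /vlineP[l vl].
  have l0 : l != 0 by apply: contraNneq v0; rewrite vl => ->; rewrite scale0r.
  by rewrite -(scale1r 1) -(mulVf l0) -scalerA -vl memvZ.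
(* From [Alt tau = F v] one gets [tau x = x + m v]; then [x v + tau (x v) = x v + v x + m a] lies on
   [F v] too. *)
have br x : exists b c : F, v * x + x * v = b%:A + c *: v.
  have := mem_Alt tau charF2 x; rewrite AltE => /vlineP[m xm].
  have := mem_Alt tau charF2 (x * v); rewrite AltE => /vlineP[l].
  have [-> _ _] := tau_inv; rewrite (Alt_fixed charF2 tau_inv vA).
  have -> : tau x = m *: v + x by rewrite -xm addrAC (addrr_pchar2 charQ2) add0r.
  rewrite mulrDr -scalerAr vv scalerA => xl; exists (m * a), l.
  by rewrite -xl [RHS]addrCA [_%:A + _]addrA (addrr_pchar2 charQ2) add0r addrC.
split=> //.
- by rewrite !free_cons nil_free span_seq1 span_nil memv0 v0 -AltE !andbT.
- by move=> x; have [b [l ->]] := br x; rewrite memv_add ?memvZ ?memv_line.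
- exact: inner_derivation_one vv vN1 br.
Qed.

(** * Tensor products *)

Lemma linear_tensor_ext (F : fieldType) (n : nat) (Q : 'I_n -> falgType F)
    (T V : lmodType F) (t : (forall i, Q i) -> T) (f g : {linear T -> V}) :
  is_tensor_product t -> (forall x, f (t x) = g (t x)) -> f =1 g.
Proof.
case=> tlin univ fg; have [|_ uniq] := univ V (fun x => g (t x)).
  by move=> x i a y z; rewrite tlin linearP.
exact: uniq.
Qed.

Lemma tensor_functional (F : fieldType) (n : nat) (Q : 'I_n -> falgType F)
    (T : lmodType F) (t : (forall i, Q i) -> T)
    (phi : forall i, {linear Q i -> F^o}) :
  is_tensor_product t ->
  exists f : {linear T -> F^o}, forall x, f (t x) = \prod_i phi i (x i).
Proof.
case=> _ univ; have [|[f fE] _] := univ F^o (fun x => \prod_i phi i (x i)).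
  move=> x i a y z; have split_i u : \prod_j phi j (dfwith x u j) =
      phi i u * \prod_(j | j != i) phi j (x j).
    rewrite (bigD1 i) //= dfwith_in; congr (_ * _).
    by apply: eq_bigr => j ji; rewrite dfwith_out // eq_sym.
  by rewrite !split_i linearP mulrDl -scalerAl.
by exists f.
Qed.

Lemma sqr_sum_pchar2 (A : nzRingType) (I : Type) (r : seq I) (a : I -> A) :
  2%N \in [pchar A] -> (forall i j, a i * a j = a j * a i) ->
  (\sum_(i <- r) a i) * (\sum_(i <- r) a i) = \sum_(i <- r) a i * a i.
Proof.
move=> A2 aC; elim: r => [|i r IHr]; first by rewrite !big_nil mul0r.
rewrite !big_cons mulrDl !mulrDr IHr.
have -> : (\sum_(j <- r) a j) * a i = a i * \sum_(j <- r) a j.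
  by rewrite mulr_suml mulr_sumr; apply: eq_bigr => j _; rewrite aC.
rewrite (@GRing.add A).[AC (2*2) (1*4*(2*3))].
by rewrite (addrr_pchar2 A2) addr0.
Qed.

(** * Pure tensors and the embedded tensor factors *)

Section PureTensors.

Variables (F : fieldType) (n : nat) (A : falgType F) (Q : 'I_n -> falgType F).
Variable t : (forall i, Q i) -> A.
Hypotheses (t_tensor : is_tensor_product t) (t1 : t (fun=> 1) = 1)
           (tM : forall x y, t x * t y = t (fun i => x i * y i)).

Let eq_t x y : (forall i, x i = y i) -> t x = t y.
Proof. by move=> xy; congr t; apply: functional_extensionality_dep. Qed.

Lemma tensorD x i (y z : Q i) :
  t (dfwith x (y + z)) = t (dfwith x y) + t (dfwith x z).
Proof. by rewrite -[y]scale1r t_tensor.1 !scale1r. Qed.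

Definition slot i (y : Q i) : A := t (dfwith (fun j => 1 : Q j) y).

Lemma slot_is_linear i : linear (@slot i).
Proof. by move=> a y z; rewrite /slot t_tensor.1. Qed.

HB.instance Definition _ i :=
  GRing.isLinear.Build F (Q i) A _ (@slot i) (@slot_is_linear i).

Lemma slot_tensor i (y : Q i) x : slot y * t x = t (dfwith x (y * x i)).
Proof.
rewrite tM; apply: eq_t => j; have [<-|ij] := eqVneq i j.
  by rewrite !dfwith_in.
by rewrite !dfwith_out // mul1r.
Qed.

Lemma tensor_slot i (y : Q i) x : t x * slot y = t (dfwith x (x i * y)).
Proof.
rewrite tM; apply: eq_t => j; have [<-|ij] := eqVneq i j.
  by rewrite !dfwith_in.
by rewrite !dfwith_out // mulr1.
Qed.

Lemma tensor_dfwith x i (y z : Q i) :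
  t (dfwith (dfwith x y) z) = t (dfwith x z).
Proof.
apply: eq_t => j; have [<-|ij] := eqVneq i j; first by rewrite !dfwith_in.
by rewrite !dfwith_out.
Qed.

Lemma slot1 i : slot (1 : Q i) = 1.
Proof.
rewrite -t1; apply: eq_t => j; have [<-|ij] := eqVneq i j.
  by rewrite dfwith_in.
by rewrite dfwith_out.
Qed.

Lemma slotM i (y z : Q i) : slot y * slot z = slot (y * z).
Proof.
rewrite slot_tensor dfwith_in; apply: eq_t => j.
by have [<-|ij] := eqVneq i j; rewrite ?dfwith_in ?dfwith_out.
Qed.

Lemma slotX i (y : Q i) k : slot (y ^+ k) = slot y ^+ k.
Proof. by elim: k => [|k IHk]; rewrite ?slot1 // !exprS -slotM IHk. Qed.

Lemma slotC i j (y : Q i) (z : Q j) : i != j -> slot y * slot z = slot z * slot y.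
Proof.
move=> ij; rewrite !tM; apply: eq_t => k.
have [ik|ik] := eqVneq i k; last by rewrite (dfwith_out _ _ ik) mul1r mulr1.
by rewrite [dfwith _ z k]dfwith_out ?mul1r ?mulr1 // -ik eq_sym.
Qed.

Lemma prod_slot x : \prod_i slot (x i) = t x.
Proof.
have tprod r (X : 'I_n -> forall j, Q j) :
    \prod_(i <- r) t (X i) = t (fun j => \prod_(i <- r) X i j).
  elim: r => [|i r IHr].
    by rewrite big_nil -t1; apply: eq_t => j; rewrite big_nil.
  by rewrite big_cons IHr tM; apply: eq_t => j; rewrite big_cons.
rewrite tprod; apply: eq_t => j.
rewrite [LHS](_ : _ = \prod_(i | i == j) dfwith (fun j => 1 : Q j) (x i) j).
  by rewrite big_pred1_eq dfwith_in.
rewrite [RHS]big_mkcond; apply: eq_bigr => i _.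
by have [//|ij] := eqVneq i j; rewrite dfwith_out.
Qed.

End PureTensors.

(** If [k] and [l] differ at [i], the off-diagonal entry of the [i]-th Gram matrix kills the term;
    on the diagonal the exponent [k i] selects 1 or [alpha i]. *)
Lemma pfister_diag (F : fieldType) (n : nat) (alpha : 'I_n -> F)
    (c : {ffun {ffun 'I_n -> 'I_2} -> F^o}) :
  pfister alpha c c =
  \sum_k (c k : F) ^+ 2 * \prod_i alpha i ^+ nat_of_ord (k i).
Proof.
apply: eq_bigr => k _; rewrite (bigD1 k) //= [X in _ + X]big1 ?addr0 => [|l lk].
  rewrite expr2.
  congr (_ * _); apply: eq_bigr => i _; rewrite mxE eqxx.
  by case: (k i) => [[|[|m]] ltm].
have [i kl] : exists i, k i != l i.
  apply/existsP; apply: contraNT lk; rewrite negb_exists => /forallP kl.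
  by apply/eqP/ffunP=> i; apply/eqP; rewrite eq_sym -[_ == _]negbK.
by rewrite (bigD1 i) //= mxE (negPf kl) mul0r mulr0.
Qed.

(** * The commutative subalgebra generated by one element of each factor *)

Section MultiquadraticSubalgebra.

Variables (F : fieldType) (n : nat) (A : falgType F) (Q : 'I_n -> falgType F).
Variable t : (forall i, Q i) -> A.
Hypotheses (charF2 : 2%N \in [pchar F])
           (t_tensor : is_tensor_product t) (t1 : t (fun=> 1) = 1)
           (tM : forall x y, t x * t y = t (fun i => x i * y i)).
Variables (alpha : 'I_n -> F) (v z : forall i, Q i).
Hypotheses (v_sqr : forall i, v i * v i = (alpha i)%:A)
           (v_free : forall i, free [:: 1; v i])
           (v_ad : forall i x, v i * x + x * v i \in (1 + <[v i]>)%VS)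
           (vz : forall i, v i * z i + z i * v i = 1).

Local Notation K := {ffun 'I_n -> 'I_2}.

Let charA2 : 2%N \in [pchar A].
Proof. by rewrite (pchar_lalg A). Qed.

Definition multiquadratic_gen i : A := slot t (v i).
Local Notation w := multiquadratic_gen.

Definition multiquadratic : {aspace A} := <<1 & [tuple w i | i < n]>>%AS.

Definition multiquadratic_basis (k : K) : A := \prod_i w i ^+ k i.
Local Notation e := multiquadratic_basis.

Definition multiquadratic_comb (c : {ffun K -> F^o}) : A := \sum_k c k *: e k.
Local Notation L := multiquadratic_comb.

Lemma multiquadratic_comb_is_linear : linear L.
Proof.
move=> a c d; rewrite /L scaler_sumr -big_split; apply: eq_bigr => k _ /=.
by rewrite !ffunE scalerDl scalerA.
Qed.

HB.instance Definition _ :=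
  GRing.isLinear.Build F {ffun K -> F^o} A _ L multiquadratic_comb_is_linear.

Lemma multiquadratic_basisE k : e k = t (fun i => v i ^+ k i).
Proof.
rewrite -prod_slot //; by apply: eq_bigr => i _; rewrite slotX.
Qed.

Lemma multiquadratic_genC i j : w i * w j = w j * w i.
Proof. by have [->//|ij] := eqVneq i j; rewrite /w slotC. Qed.

Lemma multiquadratic_basisC k l : e k * e l = e l * e k.
Proof.
rewrite !multiquadratic_basisE !tM; congr t.
by apply: functional_extensionality_dep => i; rewrite -!exprD addnC.
Qed.

Lemma multiquadratic_basis_sqr k : e k * e k = (\prod_i alpha i ^+ k i)%:A.
Proof.
rewrite multiquadratic_basisE tM -prod_slot // -[RHS]/(in_alg A _) rmorph_prod.
apply: eq_bigr => i _.
have -> : v i ^+ k i * v i ^+ k i = (alpha i ^+ k i)%:A.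
  rewrite -exprMn_comm // v_sqr -[_%:A]/(in_alg (Q i) _) -rmorphXn //.
by rewrite linearZ /= slot1.
Qed.

Lemma multiquadratic_comb_sqr c : L c * L c = (pfister alpha c c)%:A.
Proof.
rewrite sqr_sum_pchar2 // => [|k l]; last first.
  by rewrite -!scalerAl -!scalerAr !scalerA multiquadratic_basisC mulrC.
rewrite pfister_diag scaler_suml; apply: eq_bigr => k _.
by rewrite -scalerAl -scalerAr !scalerA multiquadratic_basis_sqr scalerA expr2.
Qed.

Lemma multiquadratic_comb_inj : injective L.
Proof.
apply: raddf_inj => c Lc; apply/ffunP=> l; rewrite ffunE.
(* The product of the coordinate functionals at [l i] reads off the coefficient of [e l]. *)
have [f fE] := tensor_functional
    (fun i => coord [tuple 1; v i] (l i) : {linear Q i -> F^o}) t_tensor.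
have fe k : f (e k) = (k == l)%:R.
  rewrite multiquadratic_basisE fE.
  have vk i : v i ^+ k i = [tuple 1; v i]`_(k i) by case: (k i) => [[|[|m]] ltm].
  transitivity (\prod_i ((k i == l i)%:R : F)).
    apply: eq_bigr => i _; rewrite vk.
    by rewrite -[LHS]/(coord [tuple 1; v i] (l i) _) coord_free.
  have [->|kl] := eqVneq k l; first by rewrite big1 // => i _; rewrite eqxx.
  have [i kli] : exists i, k i != l i.
    apply/existsP; apply: contraNT kl; rewrite negb_exists => /forallP kl.
    by apply/eqP/ffunP=> i; apply/eqP; rewrite -[_ == _]negbK.
  by rewrite (bigD1 i) //= (negPf kli) mul0r.
have := congr1 f Lc; rewrite raddf0 linear_sum (bigD1 l) //= big1 => [|k kl].
  by rewrite linearZ fe eqxx addr0 /= => <-; rewrite /GRing.scale /= mulr1.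
by rewrite linearZ_LR fe (negPf kl) scaler0.
Qed.

Lemma mem_multiquadratic_basis k : e k \in multiquadratic.
Proof.
have wP i : w i \in multiquadratic.
  by apply: seqv_sub_adjoin; apply/tnthP; exists i; rewrite tnth_mktuple.
have oneP : 1 \in multiquadratic by apply: (subvP (sub1_agenv _)); rewrite memv_line.
apply: (big_ind (fun x => x \in multiquadratic)) => // [x y|i _]; first exact: memvM.
by elim: (nat_of_ord _) => // m IHm; rewrite exprS memvM.
Qed.

Lemma limg_comb_sub : (limg (linfun L) <= multiquadratic)%VS.
Proof.
apply/subvP=> _ /memv_imgP[c _ ->]; rewrite lfunE /=.
by apply: memv_suml => k _; rewrite memvZ ?mem_multiquadratic_basis.
Qed.

(** Write each factor as a combination of 1 and [v i], and expand the product of the slots into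
    monomials. *)
Lemma tensor_multiquadratic x :
  (forall i, x i \in (1 + <[v i]>)%VS) -> t x \in limg (linfun L).
Proof.
move=> xv; pose c i (j : 'I_2) := coord [tuple 1; v i] j (x i).
have slotx i : slot t (x i) = \sum_(j < 2) c i j *: w i ^+ j.
  have /coord_span {1}-> : x i \in <<[tuple 1%R; v i]>>%VS.
    by rewrite span_cons span_seq1.
  rewrite linear_sum; apply: eq_bigr => j _ /=; rewrite linearZ /= -slotX //.
  by case: j => [[|[|m]] ltm].
apply/memv_imgP; exists [ffun k : K => \prod_i c i (k i)]; first exact: memvf.
rewrite lfunE /= -prod_slot //.
under eq_bigr => i _ do rewrite slotx.
rewrite bigA_distr_bigA; apply: eq_bigr => k _; rewrite ffunE.
by rewrite scaler_prod.
Qed.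

Lemma multiquadratic_sub_cent :
  (multiquadratic <= 'C(<<[tuple w i | i < n]>>))%VS.
Proof.
have sC : (<<[tuple w i | i < n]>> <= 'C(<<[tuple w i | i < n]>>))%VS.
  apply/span_subvP => _ /tnthP[i ->]; rewrite tnth_mktuple -subv_cent1.
  apply/span_subvP => _ /tnthP[j ->]; rewrite tnth_mktuple.
  by apply/cent1vP; apply: multiquadratic_genC.
have C1 : (1 <= 'C(<<[tuple w i | i < n]>>))%VS by rewrite -memvE centv1.
by apply: agenv_sub_modl => //; rewrite prodv_sub // subv_add C1.
Qed.

(** Inserting [z i], where [[v i, z i] = 1], turns the commutator with [w i] into the identity on
    elements commuting with [w i], while on pure tensors it acts in the [i]-th factor only, with
    values in [F + F v_i] there. *)
Definition slot_ad i : 'End(A) :=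
  ((amull (w i) + amulr (w i)) \o amull (slot t (z i)))%VF.

Lemma slot_ad_id i x : x * w i = w i * x -> slot_ad i x = x.
Proof.
move=> xw; rewrite comp_lfunE add_lfunE !lfunE /= -mulrA xw !mulrA -mulrDl.
by rewrite !slotM // -raddfD /= vz slot1 // mul1r.
Qed.

Lemma slot_ad_tensor i x : slot_ad i (t x) =
  t (dfwith x (v i * (z i * x i) + (z i * x i) * v i)).
Proof.
rewrite comp_lfunE add_lfunE !lfunE /= mulrA slotM // !slot_tensor // tensor_slot //.
by rewrite tensor_dfwith // dfwith_in tensorD // !mulrA.
Qed.

Definition slot_ads := foldr (fun i (P : 'End(A)) => (P \o slot_ad i)%VF) \1%VF.

Lemma slot_ads_id (r : seq 'I_n) x :
  (forall i, x * w i = w i * x) -> slot_ads r x = x.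
Proof.
move=> xw; elim: r => [|i r IHr] /=; first by rewrite id_lfunE.
by rewrite comp_lfunE slot_ad_id.
Qed.

(** The disjunction makes the induction work: [slot_ad i] acts first and brings position [i] into
    [F + F v_i], and the remaining operators keep it there. *)
Lemma slot_ads_tensor (r : seq 'I_n) x : exists2 y, slot_ads r (t x) = t y &
  forall i, (i \in r) || (x i \in 1 + <[v i]>)%VS -> y i \in (1 + <[v i]>)%VS.
Proof.
elim: r x => [|i r IHr] x /=; first by exists x; rewrite ?id_lfunE.
rewrite comp_lfunE slot_ad_tensor; set x' := dfwith x _.
have [y -> yP] := IHr x'.
exists y => // j; rewrite inE -orbA => jr; apply: yP.
have [<-|ij] := eqVneq i j; first by rewrite /x' dfwith_in v_ad orbT.
by rewrite /x' dfwith_out // -[(j \in r) || _]orFb -(negPf ij) eq_sym.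
Qed.

(* The operators [x |-> [w_i, z_i x]] fix the centralizer of the [w_i] and map
   [Q i] into [F + F v_i]. *)
Lemma cent_sub_limg_comb :
  ('C(<<[tuple w i | i < n]>>) <= limg (linfun L))%VS.
Proof.
apply/subvP=> x /centvP xC.
have xw i : x * w i = w i * x.
  apply: xC; apply: memv_span; apply/tnthP; exists i; by rewrite tnth_mktuple.
pose P := slot_ads (enum 'I_n); pose W := limg (linfun L).
(* That [P] maps into [W] is expressed as an equality of linear maps, which can be checked on pure
   tensors. *)
have PW y : P (t y) = (projv W \o P)%VF (t y).
  rewrite comp_lfunE projv_id //.
  have [y' -> y'P] := slot_ads_tensor (enum 'I_n) y.
  by apply: tensor_multiquadratic => i; apply: y'P; rewrite mem_enum.
have : P x = (projv W \o P)%VF x by apply: linear_tensor_ext t_tensor PW x.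
by rewrite comp_lfunE slot_ads_id // => ->; rewrite memv_proj.
Qed.

(** The generators commute, so the subalgebra lies in their centralizer, which lies in the span of
    the monomials, which lies in the subalgebra. *)
Lemma multiquadratic_limg : multiquadratic = limg (linfun L) :> {vspace A}.
Proof.
apply/eqP; rewrite eqEsubv limg_comb_sub andbT.
exact: subv_trans multiquadratic_sub_cent cent_sub_limg_comb.
Qed.

Lemma multiquadratic_is_Phi (sigma : {linear A -> A}) :
  (multiquadratic <= 1 + Alt sigma)%VS -> is_Phi sigma n multiquadratic.
Proof.
move=> PhiAlt.
have Phi1 : 1 \in multiquadratic.
  by apply: (subvP (sub1_agenv _)); rewrite memv_line.
have sPhi : (<<[tuple w i | i < n]>> <= multiquadratic)%VS.
  by apply/span_subvP => x xs; apply: seqv_sub_adjoin.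
split=> //.
- rewrite multiquadratic_limg limg_dim_eq; last first.
    apply/eqP; rewrite capfv; apply/lker0P => c d; rewrite !lfunE.
    exact: multiquadratic_comb_inj.
  by rewrite dimvf /dim /= card_ffun !card_ord muln1.
- move=> x; rewrite multiquadratic_limg => /memv_imgP[c _ ->].
  by rewrite lfunE /= expr2 multiquadratic_comb_sqr memvZ ?memv_line.
(* The centralizer of the subalgebra lies in that of its generators, hence in the span of the
   monomials. The converse inclusion is commutativity. *)
- apply/eqP; rewrite eqEsubv; apply/andP; split.
    apply: subv_trans limg_comb_sub; apply: subv_trans cent_sub_limg_comb.
    by rewrite centvC (subv_trans sPhi) // centvC.
  apply: agenv_sub_modl; first by rewrite -memvE centv1.
  apply: prodv_sub => //; rewrite subv_add -memvE centv1 /=.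
  by rewrite centvC multiquadratic_sub_cent.
- by exists [tuple w i | i < n].
Qed.

Lemma multiquadratic_reduced :
  (forall x, x \in multiquadratic -> x * x = 0 -> x = 0) <->
  ~ bilin_isotropic (pfister alpha).
Proof.
split=> [red [c c0 cc]|anis x].
  case/eqP: c0; apply: multiquadratic_comb_inj; rewrite raddf0; apply: red.
    by rewrite multiquadratic_limg; apply/memv_imgP; exists c; rewrite ?memvf ?lfunE.
  by rewrite multiquadratic_comb_sqr cc scale0r.
rewrite multiquadratic_limg => /memv_imgP[c _ ->]; rewrite lfunE /=.
rewrite multiquadratic_comb_sqr => /eqP; rewrite scaler_eq0 oner_eq0 orbF => /eqP cc.
have [->|c0] := eqVneq c 0; first by rewrite raddf0.
by case: anis; exists c.
Qed.

End MultiquadraticSubalgebra.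

(** The subalgebra built from the discriminant generators has the values of the Pfister form as its
    squares. *)
Lemma tensor_decomposition_Phi (F : fieldType) (A : falgType F)
    (sigma : {linear A -> A}) (n : nat) (Q : 'I_n -> falgType F)
    (tau : forall i, {linear Q i -> Q i}) (t : (forall i, Q i) -> A)
    (alpha : 'I_n -> F) :
  2%N \in [pchar F] -> involution_first_kind sigma -> orthogonal_inv sigma ->
  tensor_decomposition sigma tau t ->
  (forall i, quaternion_disc (tau i) (alpha i)) ->
  exists2 Phi : {aspace A}, is_Phi sigma n Phi &
    (forall x, x \in Phi -> x * x = 0 -> x = 0) <->
    ~ bilin_isotropic (pfister alpha).
Proof.
move=> charF2 sigma_inv sigma_orth [csQ tau_inv t_tensor t1 tM t_inv] disc.
have tau1 i : tau i 1 = 1 by apply: involution1.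
have sigma_slot i (y : Q i) : sigma (slot t y) = slot t (tau i y).
  rewrite t_inv; congr t; apply: functional_extensionality_dep => j.
  by have [<-|ij] := eqVneq i j; rewrite ?dfwith_in ?dfwith_out ?tau1.
(* An equation [1 = y + tau y] in one factor would carry over to [A] through its slot. *)
have tau_orth i : orthogonal_inv (tau i).
  apply: contra sigma_orth => /(memAltP _ charF2)[y y1].
  by apply/(memAltP _ charF2); exists (slot t y); rewrite sigma_slot -raddfD /= -y1 slot1.
have /fin_all_exists[v vP] i :=
  quaternion_disc_generator charF2 (csQ i) (tau_inv i) (tau_orth i) (disc i).
have vA i : v i \in Alt (tau i) by case: (vP i).
have vv i : v i * v i = (alpha i)%:A by case: (vP i).
have v_free i : free [:: 1; v i] by case: (vP i).
have v_ad i x : v i * x + x * v i \in (1 + <[v i]>)%VS by case: (vP i).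
have /fin_all_exists[z vz] i : exists z, v i * z + z * v i = 1 by case: (vP i).
exists (multiquadratic t v); last first.
  exact: multiquadratic_reduced vv v_free v_ad vz.
apply: (multiquadratic_is_Phi _ _ _ _ vv v_free v_ad vz) => //.
rewrite (multiquadratic_limg _ _ _ v_ad vz) //.
apply/subvP=> _ /memv_imgP[c _ ->]; rewrite lfunE /=.
apply: memv_suml => k _; apply: memvZ.
have [i ki|k0] := pickP (fun i => k i != 0); last first.
  rewrite /multiquadratic_basis big1 => [|i _]; first by rewrite memvE addvSl.
  by have /negbFE/eqP-> := k0 i.
apply/(subvP (addvSr _ _)).
rewrite multiquadratic_basisE //.
(* In a monomial involving [v i = y + tau y], all other factors are fixed by their involutions, so
   the monomial is [m + sigma m], where [m] has [y] in place of [v i]. *)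
have [y vy] := memAltP _ charF2 _ (vA i).
pose x j := v j ^+ k j.
have -> : t x = t (dfwith x y) + t (dfwith x (tau i y)).
  rewrite -tensorD // -vy; congr t; apply: functional_extensionality_dep => j.
  have [<-|ij] := eqVneq i j; last by rewrite dfwith_out.
  by rewrite dfwith_in /x; case: (k i) ki => [[|[|m]] ltm].
have -> : t (dfwith x (tau i y)) = sigma (t (dfwith x y)).
  rewrite t_inv; congr t; apply: functional_extensionality_dep => j.
  have [<-|ij] := eqVneq i j; first by rewrite !dfwith_in.
  rewrite !dfwith_out // /x; case: (k j) => [[|[|m]] ltm] //=; first by rewrite tau1.
  by rewrite (Alt_fixed charF2).
exact: mem_Alt.
Qed.

Theorem theorem4p1 (F : fieldType) (charF2 : 2%N \in [pchar F])
    (A : falgType F) (sigma : {linear A -> A})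
    (A_csa : central_simple A)
    (sigma_inv : involution_first_kind sigma)
    (sigma_orth : orthogonal_inv sigma)
    (n : nat) (Q : 'I_n -> falgType F) (tau : forall i, {linear Q i -> Q i})
    (t : (forall i, Q i) -> A)
    (sigma_dec : tensor_decomposition sigma tau t)
    (alpha : 'I_n -> F)
    (alpha_disc : forall i, quaternion_disc (tau i) (alpha i)) :
  (forall Phi : {aspace A}, is_Phi sigma n Phi ->
     [<-> ~ inv_isotropic sigma;
          inv_direct sigma;
          ~ bilin_isotropic (pfister alpha);
          ~ quad_isotropic (alternator_subalgebra sigma) (alternator_form sigma);
          is_field (mem Phi);
          is_field (alternator_subalgebra sigma);
          Phi =i alternator_subalgebra sigma;
          {subset alternator_subalgebra sigma <= Sym sigma}]) /\
  (~ inv_isotropic sigma -> exists! Phi : {aspace A}, is_Phi sigma n Phi).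
Proof.
have [Phi0 Phi0P pfE] := tensor_decomposition_Phi charF2 sigma_inv sigma_orth
                           sigma_dec alpha_disc.
(* Directness of [sigma] does not mention [Phi], so it carries the Pfister criterion from [Phi0] to
   any other such subalgebra. *)
have red_direct (Phi : {aspace A}) (PhiP : is_Phi sigma n Phi) :
    (forall x, x \in Phi -> x * x = 0 -> x = 0) -> inv_direct sigma.
  exact: Phi_reduced_direct PhiP.
have direct_red (Phi : {aspace A}) (PhiP : is_Phi sigma n Phi) :
    inv_direct sigma -> forall x, x \in Phi -> x * x = 0 -> x = 0.
  by move/direct_anisotropic; apply: anisotropic_reduced PhiP.
have directS (Phi : {aspace A}) (PhiP : is_Phi sigma n Phi) :
    inv_direct sigma -> Phi =i alternator_subalgebra sigma.
  exact: direct_alternatorE PhiP.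
split=> [Phi PhiP|anis]; last first.
  have dir := red_direct _ Phi0P (anisotropic_reduced charF2 sigma_inv Phi0P anis).
  (* Both subalgebras coincide with the alternator subalgebra. *)
  exists Phi0; split=> // Phi PhiP; apply/val_inj/vspaceP => x.
  by rewrite [LHS](directS _ Phi0P dir) -(directS _ PhiP dir).
have directE := direct_quad_anisotropic charF2 sigma_inv sigma_orth.
have fieldE := Phi_field_reduced PhiP.
tfae.
- by move/(anisotropic_reduced charF2 sigma_inv PhiP)/(red_direct _ PhiP).
- by move=> dir; apply/pfE; apply: direct_red.
- by move=> /pfE red; apply/directE; apply: red_direct red.
- by move=> /directE dir; apply/fieldE; apply: direct_red.
(* Once [Phi] is a field, it equals the alternator subalgebra, and the field property transfers
   along this equality. *)
- move=> Phi_field; have /fieldE/(red_direct _ PhiP)/(directS _ PhiP) := Phi_field.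
  by move/eq_is_field; apply.
- move/(alternator_field_reduced charF2 sigma_inv PhiP)/(red_direct _ PhiP).
  exact: directS.
- by move=> PhiS x; rewrite -PhiS => /(Phi_fixed charF2 sigma_inv PhiP)/eqP.
- move/(alternator_sym_Phi charF2 sigma_inv PhiP).
  move/(alternatorE_reduced charF2 sigma_inv PhiP A_csa)/(red_direct _ PhiP).
  exact: direct_anisotropic.
Qed.
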